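(* Let $M_{mon}$ denote the problem of computing, from the coefficient vectors of two polynomials in $\mathbb{R}[x]$ of degree $d=n-1$ expressed in the monomial basis $(x^k)_{k\ge0}$, the coefficient vector of their product in the monomial basis; and let $M_{che}$ denote the problem of computing, from the coefficient vectors of two polynomials in $\mathbb{R}[x]$ of degree $d=n-1$ expressed in the Chebyshev basis $(T_k)_{k\ge0}$, the coefficient vector of their product in the Chebyshev basis. Then $M_{mon}$ and $M_{che}$ are equivalent under linear-time transforms: each problem can be solved using two calls to an algorithm for the other problem (on inputs of the same size $n$) plus $O(n)$ additional arithmetic operations in $\mathbb{R}$; that is, the constant of both reductions is equal to two.
   Context: Chebyshev polynomials of the first kind are defined by $T_0(x)=1$, $T_1(x)=x$, $T_k(x)=2xT_{k-1}(x)-T_{k-2}(x)$ for $k\ge 2$; they form a basis of the $\mathbb{R}$-vector space $\mathbb{R}[x]$, and satisfy $T_iT_j=\frac12(T_{i+j}+T_{|i-j|})$ for all $i,j\ge0$. Data movements (copying, reversing coefficient vectors) are free; only arithmetic operations in $\mathbb{R}$ are counted. *)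

(* Defs.v *)
From mathcomp Require Import all_boot all_order all_algebra.
From mathcomp Require Import reals.

Set Implicit Arguments.
Unset Strict Implicit.
Unset Printing Implicit Defensive.

Import Order.TTheory GRing.Theory Num.Theory.
Local Open Scope ring_scope.

Section Bases.
Variable R : realType.

Fixpoint chebyshev (k : nat) : {poly R} :=
  match k with
  | 0 => 1
  | 1 => 'X
  | (k2.+1 as k1).+1 => 2 *: 'X * chebyshev k1 - chebyshev k2
  end.

Definition monomial (k : nat) : {poly R} := 'X^k.

(* The polynomial with coefficient vector v in the basis b. *)
Definition lincomb (b : nat -> {poly R}) (m : nat) (v : 'rV[R]_m) : {poly R} :=
  \sum_(i < m) v 0 i *: b i.

(* Input/output behaviour of a procedure on two vectors of n coefficients     *)
(* (degree n - 1), returning 2n - 1 coefficients; None means that the         *)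
(* procedure fails, e.g. on a division by zero.                               *)
Definition procedure (n : nat) : Type :=
  'rV[R]_n -> 'rV[R]_n -> option 'rV[R]_(n + n).-1.

Definition solves_mul (b : nat -> {poly R}) (n : nat) (A : procedure n) : Prop :=
  forall u v : 'rV[R]_n, exists2 w : 'rV[R]_(n + n).-1,
    A u v = Some w & lincomb b w = lincomb b u * lincomb b v.

End Bases.

(* Straight-line programs over R with calls to a black-box procedure of size  *)
(* n. The memory is an append-only sequence of reals: each instruction reads  *)
(* operands by address and appends its results, so copying and reordering     *)
(* data costs nothing.                                                        *)

Inductive arith := Add | Sub | Mul | Div.

Section Programs.
Variables (R : realType) (n : nat).

Inductive instr :=
  | Const (c : R)
  | Op (o : arith) (i j : nat)
  | Call (a b : n.-tuple nat).

Record program := Program {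
  code : seq instr;
  output : (n + n).-1.-tuple nat }.

Definition arith_eval (o : arith) (x y : R) : option R :=
  match o with
  | Add => Some (x + y)
  | Sub => Some (x - y)
  | Mul => Some (x * y)
  | Div => if y == 0 then None else Some (x / y)
  end.

Definition load (m : nat) (s : seq R) (a : m.-tuple nat) : option 'rV[R]_m :=
  if all (fun i => i < size s)%N a then Some (\row_k s`_(tnth a k)) else None.

Definition entries (m : nat) (v : 'rV[R]_m) : seq R := [seq v 0 k | k : 'I_m].

Definition step (A : procedure R n) (s : seq R) (c : instr) : option (seq R) :=
  match c with
  | Const x => Some (rcons s x)
  | Op o i j =>
      if ((i < size s) && (j < size s))%N
      then omap (rcons s) (arith_eval o s`_i s`_j) else None
  | Call a b =>
      if (load s a, load s b) is (Some u, Some v)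
      then omap (fun w => s ++ entries w) (A u v) else None
  end.

Definition run (A : procedure R n) (cs : seq instr) (s : seq R) :
    option (seq R) :=
  foldl (fun os c => obind (fun s' => step A s' c) os) (Some s) cs.

Definition exec (A : procedure R n) (P : program) : procedure R n :=
  fun u v =>
    obind (fun s => load s (output P)) (run A (code P) (entries u ++ entries v)).

Definition num_ops (P : program) : nat :=
  count (fun c => if c is Op _ _ _ then true else false) (code P).

Definition num_calls (P : program) : nat :=
  count (fun c => if c is Call _ _ then true else false) (code P).

End Programs.

(* Multiplication in the basis b reduces to multiplication in the basis b',   *)
(* with constant k: k calls, on inputs of the same size n, plus O(n)          *)
(* arithmetic operations.                                                     *)
Definition linear_time_reduction (R : realType) (k : nat)
    (b b' : nat -> {poly R}) : Prop :=
  exists C : nat, forall n : nat, (0 < n)%N ->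
    exists P : program R n,
      [/\ num_calls P = k, (num_ops P <= C * n)%N &
          forall A : procedure R n, solves_mul b' A -> solves_mul b (exec A P)].

(* Main.v *)
Require Import Defs.
From mathcomp Require Import all_boot all_order all_algebra.
From mathcomp Require Import reals.
From mathcomp Require Import zify ring.

(* Write d = n - 1, c_k for the sum of the u_i v_j over i + j = k, and D_k for  *)
(* the same sum over |i - j| = k. Since T_i T_j = (T_(i+j) + T_|i-j|) / 2, the   *)
(* Chebyshev coefficients of the product are (c_k + D_k) / 2, while c_k are the *)
(* monomial ones.                                                               *)
(*   From monomial to Chebyshev: multiplying u by v gives c, and multiplying u  *)
(* by the reversal of v gives the sums over a fixed i - j, hence D.             *)
(*   From Chebyshev to monomial: D_k = 0 for k > d, so multiplying u by v gives *)
(* c_k for k > d, and multiplying the reversals gives c_(2d-k) for k > d. The   *)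
(* only one left is c_d, corrected by D_d = u_0 v_d + u_d v_0 (for d > 0).      *)

Set Implicit Arguments.
Unset Strict Implicit.
Unset Printing Implicit Defensive.

Import Order.TTheory GRing.Theory Num.Theory.
Local Open Scope ring_scope.

(** The black box is known only through its specification. Both bases have exactly one polynomial of
    each degree, so coefficient vectors are unique and [solves_mulP] turns the specification into an
    explicit bilinear formula, [conv] or [chebyshev_conv]. The rest is bookkeeping on indices:
    [corr_reversed] obtains D from a product with a reversed vector, while [conv_of_chebyshev],
    [conv_reversed] and [conv_of_chebyshev_mid] recover c. Two branch-free programs then carry out
    these formulas. *)

Section Coefficients.
Variable R : realType.
Implicit Types (b : nat -> {poly R}) (f g : nat -> R).

(** * Uniqueness of coordinates in a graded basis *)

Lemma lincomb_row b m f : lincomb b (\row_(k < m) f k) = \sum_(k < m) f k *: b k.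
Proof. by apply: eq_bigr => k _; rewrite mxE. Qed.

Lemma row_entries m (u : 'rV[R]_m) : u = \row_(k < m) (entries u)`_k.
Proof.
apply/rowP => k; rewrite mxE /entries (nth_map k) ?nth_ord_enum //.
by rewrite size_enum_ord.
Qed.

Lemma entries_row m f : entries (\row_(k < m) f k) = mkseq f m.
Proof.
rewrite /entries /mkseq -val_enum_ord -map_comp.
by apply: eq_map => k /=; rewrite mxE.
Qed.

(** Only the last term reaches degree [m], so its coefficient vanishes; induct on the others. *)
Lemma sum_graded_eq0 b m f :
  (forall k, size (b k) = k.+1) -> \sum_(i < m) f i *: b i = 0 ->
  forall k, (k < m)%N -> f k = 0.
Proof.
move=> sz; elim: m => // m IH; rewrite big_ord_recr /= => h k.
have lead : f m = 0.
  have := congr1 (fun p : {poly R} => p`_m) h.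
  rewrite coefD coef_sum big1 => [|i _].
    rewrite add0r coefZ coef0 => /eqP; rewrite mulf_eq0 => /orP[/eqP->//|].
    have -> : (b m)`_m = lead_coef (b m) by rewrite lead_coefE sz.
    by rewrite lead_coef_eq0 -size_poly_eq0 sz.
  by rewrite coefZ nth_default ?mulr0 // sz.
rewrite ltnS leq_eqVlt => /orP[/eqP->//|].
by apply: IH; rewrite lead scale0r addr0 in h.
Qed.

Lemma lincomb_inj b m :
  (forall k, size (b k) = k.+1) -> injective (@lincomb R b m).
Proof.
move=> sz u v /eqP; rewrite -subr_eq0 -sumrB => /eqP uv.
apply/eqP; rewrite -subr_eq0 (row_entries (u - v)); apply/eqP/rowP => k.
rewrite [LHS]mxE [RHS]mxE.
apply: (@sum_graded_eq0 b m (nth 0 (entries (u - v))) sz _ k (ltn_ord k)).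
rewrite -lincomb_row -row_entries -[RHS]uv.
by apply: eq_bigr => i _; rewrite !mxE scalerBl.
Qed.

(** By injectivity of [lincomb], a correct [A] has no freedom in its answer, so a program calling it
    can be executed symbolically. *)
Lemma solves_mulP b n (F : (nat -> R) -> (nat -> R) -> nat -> R) :
  (forall k, size (b k) = k.+1) ->
  (forall f g, (\sum_(i < n) f i *: b i) * (\sum_(j < n) g j *: b j) =
               \sum_(k < (n + n).-1) F f g k *: b k) ->
  forall A : procedure R n,
  solves_mul b A <->
  (forall f g, A (\row_k f k) (\row_k g k) = Some (\row_k F f g k)).
Proof.
move=> sz mulF A; split=> [sA f g | AF u v].
  have [w -> /esym] := sA (\row_k f k) (\row_k g k).
  rewrite !lincomb_row mulF -(lincomb_row b).
  by move/(lincomb_inj sz) => ->.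
rewrite (row_entries u) (row_entries v); eexists; first exact: AF.
by rewrite !lincomb_row mulF.
Qed.

(** * Bilinear sums over selected pairs of indices *)

Definition bisum (n : nat) f g (P : nat -> nat -> bool) : R :=
  \sum_(i < n) \sum_(j < n) (f i * g j) *+ P i j.

Definition conv n f g (k : nat) := bisum n f g (fun i j => i + j == k)%N.

(** With truncated subtraction, [(i - j) + (j - i)] is |i - j|. *)
Definition corr n f g (k : nat) := bisum n f g (fun i j => (i - j) + (j - i) == k)%N.

Definition chebyshev_conv n f g (k : nat) := (conv n f g k + corr n f g k) / 2.

Definition reversed n f (j : nat) : R := f (n - j.+1)%N.

(** Identities between such sums reduce to facts about pairs of indices, within reach of [lia]. *)
Lemma eq_bisum n f g (P Q : nat -> nat -> bool) :
  (forall i j, i < n -> j < n -> P i j = Q i j)%N ->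
  bisum n f g P = bisum n f g Q.
Proof. by move=> PQ; apply: eq_bigr => i _; apply: eq_bigr => j _; rewrite PQ. Qed.

Lemma bisum_reversed_l n f g P :
  bisum n (reversed n f) g P = bisum n f g (fun i j => P (n - i.+1)%N j).
Proof.
rewrite /bisum (reindex_inj rev_ord_inj); apply: eq_bigr => i _.
apply: eq_bigr => j _; rewrite /reversed /=; congr (f _ * _ *+ _).
by have := ltn_ord i; lia.
Qed.

Lemma bisum_reversed_r n f g P :
  bisum n f (reversed n g) P = bisum n f g (fun i j => P i (n - j.+1)%N).
Proof.
rewrite /bisum; apply: eq_bigr => i _.
rewrite (reindex_inj rev_ord_inj); apply: eq_bigr => j _.
rewrite /reversed /=; congr (_ * g _ *+ _).
by have := ltn_ord j; lia.
Qed.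

Lemma bisum_pred0 n f g (P : nat -> nat -> bool) :
  (forall i j, i < n -> j < n -> ~~ P i j)%N -> bisum n f g P = 0.
Proof.
move=> P0; rewrite /bisum big1 // => i _; rewrite big1 // => j _.
by rewrite (negbTE (P0 _ _ _ _)).
Qed.

Lemma bisum_pred1 n f g (P : nat -> nat -> bool) i0 j0 :
  (i0 < n)%N -> (j0 < n)%N ->
  (forall i j, i < n -> j < n -> P i j = (i == i0) && (j == j0))%N ->
  bisum n f g P = f i0 * g j0.
Proof.
move=> lti ltj P1; rewrite /bisum (bigD1 (Ordinal lti)) //= [X in _ + X]big1 => [|i ne_i].
  rewrite addr0 (bigD1 (Ordinal ltj)) //= big1 => [|j ne_j].
    by rewrite addr0 P1 // !eqxx.
  by rewrite P1 // -val_eqE /= in ne_j *; rewrite (negbTE ne_j) andbF.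
rewrite big1 // => j _.
by rewrite P1 // -val_eqE /= in ne_i *; rewrite (negbTE ne_i).
Qed.

(** Booleans are added as naturals, so the hypothesis says that [S] is the disjoint union of [P] and
    [Q]. *)
Lemma bisumD n f g (P Q S : nat -> nat -> bool) :
  (forall i j, i < n -> j < n -> S i j = P i j + Q i j :> nat)%N ->
  bisum n f g S = bisum n f g P + bisum n f g Q.
Proof.
move=> SPQ; rewrite /bisum -big_split; apply: eq_bigr => i _.
by rewrite -big_split; apply: eq_bigr => j _; rewrite SPQ //= mulrnDr.
Qed.

(** Each pair contributes to exactly one [k], namely [h i j], which the bound keeps in range. *)
Lemma sum_bisum b n m f g (h : nat -> nat -> nat) :
  (forall i j, i < n -> j < n -> h i j < m)%N ->
  \sum_(k < m) bisum n f g (fun i j => h i j == k) *: b k =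
  \sum_(i < n) \sum_(j < n) (f i * g j) *: b (h i j).
Proof.
move=> hm; under eq_bigr do rewrite scaler_suml.
rewrite exchange_big; apply: eq_bigr => i _ /=.
under eq_bigr do rewrite scaler_suml.
rewrite exchange_big; apply: eq_bigr => j _ /=.
rewrite (bigD1 (Ordinal (hm i j _ _))) //= eqxx big1 ?addr0 // => k.
by rewrite -val_eqE /= eq_sym => /negbTE->; rewrite mulr0n scale0r.
Qed.

Lemma mul_lincomb b n f g :
  (\sum_(i < n) f i *: b i) * (\sum_(j < n) g j *: b j) =
  \sum_(i < n) \sum_(j < n) (f i * g j) *: (b i * b j).
Proof.
rewrite mulr_suml; apply: eq_bigr => i _; rewrite mulr_sumr.
by apply: eq_bigr => j _; rewrite -scalerAl -scalerAr scalerA.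
Qed.

Lemma monomial_mul n f g :
  (\sum_(i < n) f i *: monomial R i) * (\sum_(j < n) g j *: monomial R j) =
  \sum_(k < (n + n).-1) conv n f g k *: monomial R k.
Proof.
rewrite mul_lincomb sum_bisum => [|i j]; last by lia.
by apply: eq_bigr => i _; apply: eq_bigr => j _; rewrite /monomial exprD.
Qed.

(** * Products of Chebyshev polynomials *)

Lemma chebyshevSS k :
  chebyshev R k.+2 = 2 * 'X * chebyshev R k.+1 - chebyshev R k.
Proof. by rewrite /= scaler_nat mulr_natl. Qed.

Lemma size_chebyshev k : size (chebyshev R k) = k.+1.
Proof.
suff: size (chebyshev R k) = k.+1 /\ size (chebyshev R k.+1) = k.+2 by case.
elim: k => [|k [IH0 IH1]]; first by rewrite /= size_poly1 size_polyX.
split=> //; rewrite [chebyshev R k.+2]/= -scalerAl.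
have szX : size (2 *: ('X * chebyshev R k.+1) : {poly R}) = k.+3.
  by rewrite size_scale ?pnatr_eq0 // mulrC size_mulX -?size_poly_eq0 ?IH1.
by rewrite size_polyDl szX // size_polyN IH0.
Qed.

(** Two-step induction on [i]: the recurrence is applied upwards at [i + k] and downwards at
    [k - i]. The assumption [i <= k] keeps the subtraction exact. *)
Lemma chebyshev_mul_le i k : (i <= k)%N ->
  2 * (chebyshev R i * chebyshev R k) =
  chebyshev R (i + k) + chebyshev R (k - i).
Proof.
suff: ((i <= k)%N -> 2 * (chebyshev R i * chebyshev R k) =
        chebyshev R (i + k) + chebyshev R (k - i)) /\
      ((i < k)%N -> 2 * (chebyshev R i.+1 * chebyshev R k) =
        chebyshev R (i.+1 + k) + chebyshev R (k - i.+1)) by case.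
elim: i => [|i [IH0 IH1]]; split=> //.
- by move=> _; rewrite subn0 add0n /=; ring.
- by case: k => // k _; rewrite subSS subn0 add1n chebyshevSS /=; ring.
move=> ltik; have [{}IH0 {}IH1] := (IH0 (ltnW (ltnW ltik)), IH1 (ltnW ltik)).
rewrite chebyshevSS.
have -> : (i.+2 + k = (i + k).+2)%N by lia.
(* Rearranged, this expresses T_(k-i-2) through T_(k-i-1) and T_(k-i). *)
have := chebyshevSS (k - i.+2).
have -> : ((k - i.+2).+2 = k - i)%N by lia.
have -> : ((k - i.+2).+1 = k - i.+1)%N by lia.
move=> rec; rewrite chebyshevSS -addSn.
set T := chebyshev R in rec IH0 IH1 *.
transitivity (2 * 'X * (2 * (T i.+1 * T k)) - 2 * (T i * T k)); first by ring.
by rewrite IH0 IH1 rec; ring.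
Qed.

Lemma chebyshevM i j :
  chebyshev R i * chebyshev R j =
  2^-1 *: (chebyshev R (i + j) + chebyshev R ((i - j) + (j - i))).
Proof.
wlog le_ij : i j / (i <= j)%N.
  move=> H; case/orP: (leq_total i j) => /H // {}H.
  by rewrite mulrC H addnC [(j - i + _)%N]addnC.
have -> : ((i - j) + (j - i) = j - i)%N by lia.
rewrite -chebyshev_mul_le // mulr_natl -scaler_nat scalerA mulVf ?scale1r //.
by rewrite pnatr_eq0.
Qed.

Lemma chebyshev_mul n f g :
  (\sum_(i < n) f i *: chebyshev R i) * (\sum_(j < n) g j *: chebyshev R j) =
  \sum_(k < (n + n).-1) chebyshev_conv n f g k *: chebyshev R k.
Proof.
rewrite mul_lincomb; under [RHS]eq_bigr do
  rewrite /chebyshev_conv mulrC -scalerA scalerDl scalerDr.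
rewrite big_split /= -!scaler_sumr !sum_bisum; [|by lia..].
rewrite -scalerDr -big_split scaler_sumr; apply: eq_bigr => i _ /=.
rewrite -big_split scaler_sumr; apply: eq_bigr => j _ /=.
by rewrite -scalerDr chebyshevM !scalerA mulrC.
Qed.

(** * Passing between the two convolutions *)

Lemma size_monomial k : size (monomial R k) = k.+1.
Proof. exact: size_polyXn. Qed.

Lemma conv_eq0 n f g k : ((n + n).-1 <= k)%N -> conv n f g k = 0.
Proof. by move=> le_k; apply: bisum_pred0; lia. Qed.

(** Reversing [g] turns i + j into i - j + (n - 1), so the two terms collect i - j = k and j - i =
    k. The guard avoids counting the diagonal twice at k = 0, and excludes k >= n, where [n.-1 - k]
    would truncate to the valid index 0. *)
Lemma corr_reversed n f g k : (0 < n)%N ->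
  corr n f g k = conv n f (reversed n g) (n.-1 + k) +
    (if (0 < k < n)%N then conv n f (reversed n g) (n.-1 - k) else 0).
Proof.
move=> n_gt0; rewrite /conv !bisum_reversed_r.
case: ifPn => [k_in | k_out]; first by apply: bisumD => i j; lia.
by rewrite addr0; apply: eq_bisum => i j; lia.
Qed.

(** Reversing both vectors sends i + j to 2(n - 1) - (i + j). *)
Lemma conv_reversed n f g k : (k < (n + n).-1)%N ->
  conv n (reversed n f) (reversed n g) ((n + n).-2 - k) = conv n f g k.
Proof.
move=> k_lt; rewrite /conv bisum_reversed_l bisum_reversed_r.
by apply: eq_bisum => i j; lia.
Qed.

(** No pair has |i - j| >= n, so only the halved [conv] term is left. *)
Lemma conv_of_chebyshev n f g k : (n <= k)%N ->
  conv n f g k = chebyshev_conv n f g k + chebyshev_conv n f g k.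
Proof.
move=> le_nk; rewrite /chebyshev_conv [corr _ _ _ _]bisum_pred0; last by lia.
by field.
Qed.

(* For n = 1 the pairs (0, n - 1) and (n - 1, 0) coincide. *)
Lemma conv_of_chebyshev_mid n f g : (0 < n)%N ->
  conv n f g n.-1 =
    chebyshev_conv n f g n.-1 + chebyshev_conv n f g n.-1
    - f 0%N * g n.-1 - (if n == 1%N then 0 else f n.-1 * g 0%N).
Proof.
move=> n_gt0; rewrite /chebyshev_conv; case: ifPn => [/eqP->|n_neq1].
  by rewrite [corr _ _ _ _](@bisum_pred1 _ _ _ _ 0 0) //; [field | lia].
(* |i - j| = n - 1 holds only at the two opposite corners, which are distinct here. *)
have -> : corr n f g n.-1 = f 0%N * g n.-1 + f n.-1 * g 0%N; last by field.
rewrite -(@bisum_pred1 n f g (fun i j => (i == 0) && (j == n.-1))%N); try lia.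
rewrite -(@bisum_pred1 n f g (fun i j => (i == n.-1) && (j == 0))%N); try lia.
by apply: bisumD => i j; lia.
Qed.

End Coefficients.

(** * Symbolic execution of straight-line programs *)

Section Runs.
Variables (R : realType) (n : nat).
Implicit Types (A : procedure R n) (s : seq R) (cs : seq (instr R n)).

Definition addrs m (a : nat -> nat) : m.-tuple nat := [tuple a k | k < m].

Lemma load_addrs m s (a : nat -> nat) :
  (forall k, k < m -> a k < size s)%N ->
  load s (addrs m a) = Some (\row_k s`_(a k)).
Proof.
move=> a_lt; rewrite /load ifT; last first.
  by apply/allP => _ /mapP[k _ ->]; apply: a_lt.
by congr Some; apply/rowP => k; rewrite !mxE tnth_mktuple.
Qed.

Lemma run_cons A c cs s s1 :
  step A s c = Some s1 -> run A (c :: cs) s = run A cs s1.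
Proof. by rewrite /run /= => ->. Qed.

Lemma run_const A c cs s : run A (Const n c :: cs) s = run A cs (s ++ [:: c]).
Proof. by rewrite cats1. Qed.

Lemma run_cat A cs1 cs2 s s1 :
  run A cs1 s = Some s1 -> run A (cs1 ++ cs2) s = run A cs2 s1.
Proof. by rewrite /run foldl_cat => ->. Qed.

Lemma step_call A s (a b : nat -> nat) (f g h : nat -> R) :
  (forall k, k < n -> a k < size s)%N -> (forall k, k < n -> b k < size s)%N ->
  (forall k, (k < n)%N -> s`_(a k) = f k) ->
  (forall k, (k < n)%N -> s`_(b k) = g k) ->
  A (\row_k f k) (\row_k g k) = Some (\row_k h k) ->
  step A s (Call R (addrs n a) (addrs n b)) =
  Some (s ++ mkseq h (n + n).-1).
Proof.
move=> a_lt b_lt sa sb Afg; rewrite /step !load_addrs //.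
have -> : \row_(k < n) s`_(a k) = \row_k f k by apply/rowP => k; rewrite !mxE sa.
have -> : \row_(k < n) s`_(b k) = \row_k g k by apply/rowP => k; rewrite !mxE sb.
by rewrite Afg /= entries_row.
Qed.

Definition ops (o : arith) (a b : nat -> nat) (m : nat) : seq (instr R n) :=
  mkseq (fun i => Op R n o (a i) (b i)) m.

(** All operands lie in the initial memory [s], so operations of one batch never read each other's
    results; dependent operations go into successive batches. *)
Lemma run_ops A s o (a b : nat -> nat) (h : nat -> R) m :
  (forall i, i < m -> a i < size s)%N -> (forall i, i < m -> b i < size s)%N ->
  (forall i, (i < m)%N -> arith_eval o s`_(a i) s`_(b i) = Some (h i)) ->
  run A (ops o a b m) s = Some (s ++ mkseq h m).
Proof.
rewrite /ops; elim: m => [|m IH] a_lt b_lt abh; first by rewrite cats0.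
have {}IH := IH (fun i lt_im => a_lt i (leqW lt_im))
                (fun i lt_im => b_lt i (leqW lt_im))
                (fun i lt_im => abh i (leqW lt_im)).
rewrite !mkseqS -cats1 (run_cat _ IH).
rewrite /run /= !nth_cat !size_cat a_lt // b_lt // !ltn_addr ?a_lt ?b_lt //=.
by rewrite abh //= rcons_cat.
Qed.

(** Serves both counters: [c] is [false] when counting calls and [true] when counting operations. *)
Lemma count_ops (p : pred (instr R n)) (c : bool) o (a b : nat -> nat) m :
  (forall o i j, p (Op R n o i j) = c) -> count p (ops o a b m) = (c * m)%N.
Proof.
move=> pc; rewrite /ops /mkseq count_map (@eq_count _ _ (fun=> c)) => [|i].
  by case: c {pc}; rewrite ?count_predT ?count_pred0 ?size_iota ?mul1n ?mul0n.
exact: pc.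
Qed.

End Runs.

(* Memory layout of both programs: u and v (n cells each), the results of the  *)
(* two calls (m cells each), then from address base on the constants and the   *)
(* results of the arithmetic operations.                                       *)
Section Reductions.
Variables (R : realType) (n : nat).
Hypothesis n_gt0 : (0 < n)%N.
Implicit Types (A : procedure R n) (f g : nat -> R).

Let m := (n + n).-1.
Let base := (n + n + m + m)%N.

Ltac addr_lia :=
  rewrite ?(size_cat, size_mkseq) /= /base /m; do ?[case: ifP => ?]; lia.

(** Locates the memory block containing an address; when its offset is not syntactically the
    expected one, an equation on indices remains. *)
Ltac read :=
  rewrite ?nth_cat ?(size_cat, size_mkseq) ?[size (_ :: _)]/= /base /m;
  do ?[case: ifPn => ?; try lia]; rewrite ?nth_mkseq //; try lia.

Lemma run_two_calls (F : (nat -> R) -> (nat -> R) -> nat -> R) A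
    (a b : nat -> nat) cs f g f' g' :
  (forall f g, A (\row_k f k) (\row_k g k) = Some (\row_k F f g k)) ->
  (forall k, k < n -> a k < n + n)%N -> (forall k, k < n -> b k < n + n)%N ->
  (forall k, (k < n)%N -> (mkseq f n ++ mkseq g n)`_(a k) = f' k) ->
  (forall k, (k < n)%N -> (mkseq f n ++ mkseq g n)`_(b k) = g' k) ->
  run A [:: Call R (addrs n id) (addrs n (addn n)),
            Call R (addrs n a) (addrs n b) & cs] (mkseq f n ++ mkseq g n) =
  run A cs (((mkseq f n ++ mkseq g n) ++ mkseq (F f g) m) ++ mkseq (F f' g') m).
Proof.
move=> AF a_lt b_lt af bg.
rewrite (run_cons _ (@step_call _ _ _ _ _ _ f g _ _ _ _ _ (AF f g))).
- apply/run_cons/(step_call _ _ _ _ (AF f' g')) => k lt_k.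
  + by rewrite 2!size_cat !size_mkseq ltn_addr ?a_lt.
  + by rewrite 2!size_cat !size_mkseq ltn_addr ?b_lt.
  + by rewrite nth_cat size_cat !size_mkseq a_lt ?af.
  + by rewrite nth_cat size_cat !size_mkseq b_lt ?bg.
- by move=> k lt_k; addr_lia.
- by move=> k lt_k; addr_lia.
- by move=> k lt_k; read.
- by move=> k lt_k; read; congr g; lia.
Qed.

(** The three batches add the two halves of D_k to c_k, then halve. The constant 0 stored at [base]
    stands in for terms that are out of range. *)
Definition chebyshev_from_monomial : program R n :=
  Program
    [:: Call R (addrs n id) (addrs n (addn n)),
        Call R (addrs n id) (addrs n (fun k => n + (n - k.+1))%N),
        Const n 0, Const n 2^-1
      & ops R n Add (fun k => n + n + k)%N
          (fun k => if k < n then n + n + m + (n.-1 + k) else base)%N m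
     ++ ops R n Add (fun k => base + 2 + k)%N
          (fun k => if 0 < k < n then n + n + m + (n.-1 - k) else base)%N m
     ++ ops R n Mul (fun k => base + 2 + m + k)%N (fun=> base.+1) m]
  (addrs m (fun k => base + 2 + m + m + k)%N).

Lemma exec_chebyshev_from_monomial A f g :
  (forall f g, A (\row_k f k) (\row_k g k) = Some (\row_k conv n f g k)) ->
  exec A chebyshev_from_monomial (\row_k f k) (\row_k g k) =
  Some (\row_k chebyshev_conv n f g k).
Proof.
move=> AE; rewrite /exec !entries_row /chebyshev_from_monomial /code /output.
rewrite (@run_two_calls _ _ _ _ _ _ _ f (reversed n g) AE).
- rewrite !run_const -!catA [[:: 0] ++ _]/=.
  set h1 := fun k => conv n f g k + conv n f (reversed n g) (n.-1 + k).
  rewrite (run_cat _ (@run_ops _ _ _ _ _ _ _ h1 _ _ _ _)); first last.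
  + move=> k lt_k /=; congr Some; congr (_ + _); first by read; congr conv; lia.
    case: ifPn => lt_kn; first by read; congr conv; lia.
    (* Here [n.-1 + k] exceeds the last index of a product, so the cell [base] replaces a zero
       coefficient. *)
    rewrite conv_eq0; last by lia.
    by read; rewrite (_ : _ - _ = 0)%N //; lia.
  + by move=> k lt_k; addr_lia.
  + by move=> k lt_k; addr_lia.
  set h2 := fun k => h1 k +
    (if (0 < k < n)%N then conv n f (reversed n g) (n.-1 - k) else 0).
  rewrite (run_cat _ (@run_ops _ _ _ _ _ _ _ h2 _ _ _ _)); first last.
  + move=> k lt_k /=; congr Some; congr (_ + _); first by read; congr h1; lia.
    case: ifPn => k_in; first by read; congr conv; lia.
    by read; rewrite (_ : _ - _ = 0)%N //; lia.
  + by move=> k lt_k; addr_lia.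
  + by move=> k lt_k; addr_lia.
  rewrite (@run_ops _ _ _ _ _ _ _ (fun k => h2 k / 2)); first last.
  + move=> k lt_k /=; congr Some; congr (_ * _); first by read; congr h2; lia.
    by read; rewrite (_ : _ - _ = 1)%N //; lia.
  + by move=> k lt_k; addr_lia.
  + by move=> k lt_k; addr_lia.
  rewrite /= load_addrs => [|k lt_k]; last by addr_lia.
  congr Some; apply/rowP => k.
  rewrite !mxE /chebyshev_conv corr_reversed // addrA.
  have lt_k := ltn_ord k; rewrite -[RHS]/(h2 k / 2).
  by read; congr (h2 _ / _); lia.
- by lia.
- by lia.
- by move=> k lt_k; read.
- by move=> k lt_k; read; rewrite /reversed; congr g; lia.
Qed.

(** Where the coefficient to be doubled is stored: below [n.-1] it is the mirrored entry of the
    product of the reversals. *)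
Let src (k : nat) : nat :=
  (if k < n.-1 then n + n + m + ((n + n).-2 - k) else n + n + k)%N.

(** After the doubling, the [Mul] batch computes u_0 v_d and u_d v_0, and two subtractions correct
    the middle coefficient. For n = 1 these products coincide, so the second subtraction takes 0
    instead. *)
Definition monomial_from_chebyshev : program R n :=
  Program
    [:: Call R (addrs n id) (addrs n (addn n)),
        Call R (addrs n (fun k => n - k.+1)%N)
               (addrs n (fun k => n + (n - k.+1))%N),
        Const n 0
      & ops R n Add src src m
     ++ ops R n Mul (fun k => k * n.-1)%N (fun k => n + (1 - k) * n.-1)%N 2
     ++ ops R n Defs.Sub (fun=> base + 1 + n.-1)%N (fun=> base + 1 + m)%N 1
     ++ ops R n Defs.Sub (fun=> base + 1 + m + 2)%N
          (fun=> if n == 1 then base else base + 1 + m + 1)%N 1]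
  (addrs m (fun k => if k == n.-1 then base + 1 + m + 3 else base + 1 + k)%N).

Lemma exec_monomial_from_chebyshev A f g :
  (forall f g,
     A (\row_k f k) (\row_k g k) = Some (\row_k chebyshev_conv n f g k)) ->
  exec A monomial_from_chebyshev (\row_k f k) (\row_k g k) =
  Some (\row_k conv n f g k).
Proof.
move=> AE; rewrite /exec !entries_row /monomial_from_chebyshev /code /output.
rewrite (@run_two_calls _ _ _ _ _ _ _ (reversed n f) (reversed n g) AE).
- rewrite run_const -!catA.
  (* The middle entry is not yet a [conv] value: it still contains D_d. *)
  set h1 := fun k => if k == n.-1
    then chebyshev_conv n f g n.-1 + chebyshev_conv n f g n.-1
    else conv n f g k.
  rewrite (run_cat _ (@run_ops _ _ _ _ _ _ _ h1 _ _ _ _)); first last.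
  + move=> k lt_k /=; congr Some; rewrite /h1 /src; case: (eqVneq k n.-1) => [->|k_neq].
      by rewrite ltnn; congr (_ + _); read; congr chebyshev_conv; lia.
    case: ifPn => [lt_kn | le_nk].
      (* For k < n - 1 the mirrored index 2(n - 1) - k is at least n, so doubling is exact for the
         reversed vectors. *)
      rewrite -conv_reversed // conv_of_chebyshev; last by lia.
      by congr (_ + _); read; congr chebyshev_conv; lia.
    rewrite conv_of_chebyshev; last by lia.
    by congr (_ + _); read; congr chebyshev_conv; lia.
  + by move=> k lt_k; rewrite /src; addr_lia.
  + by move=> k lt_k; rewrite /src; addr_lia.
  set h2 := fun k => if k == 0%N then f 0%N * g n.-1 else f n.-1 * g 0%N.
  rewrite (run_cat _ (@run_ops _ _ _ _ _ _ _ h2 _ _ _ _)); first last.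
  + by move=> [|[|//]] _ /=; congr Some; congr (_ * _); read;
      rewrite ?(mul0n, mul1n) //; first [congr g | congr f]; lia.
  + by move=> [|[|//]] _; addr_lia.
  + by move=> [|[|//]] _; addr_lia.
  set y := h1 n.-1 - h2 0%N.
  rewrite (run_cat _ (@run_ops _ _ _ _ _ _ _ (fun=> y) _ _ _ _)); first last.
  + by move=> k _ /=; congr Some; congr (_ - _); read; [congr h1 | congr h2]; lia.
  + by move=> k _; addr_lia.
  + by move=> k _; addr_lia.
  set z := y - (if n == 1%N then 0 else h2 1%N).
  rewrite (@run_ops _ _ _ _ _ _ _ (fun=> z)); first last.
  + move=> k _ /=; congr Some; congr (_ - _); first by read.
    case: ifPn => n1; last by read; congr h2; lia.
    by read; rewrite (_ : _ - _ = 0)%N //; lia.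
  + by move=> k _; addr_lia.
  + by move=> k _; addr_lia.
  rewrite /= load_addrs => [|k lt_k]; last by addr_lia.
  congr Some; apply/rowP => k; rewrite !mxE.
  have lt_k := ltn_ord k; case: ifPn => [/eqP->|k_neq].
    rewrite conv_of_chebyshev_mid //; transitivity z; first by read.
    by rewrite /z /y /h1 eqxx.
  by transitivity (h1 k); [read; congr h1; lia | rewrite /h1 (negbTE k_neq)].
- by lia.
- by lia.
- by move=> k lt_k; read.
- by move=> k lt_k; read; rewrite /reversed; congr g; lia.
Qed.

End Reductions.

Theorem theorem1 (R : realType) :
  linear_time_reduction 2 (@monomial R) (@chebyshev R) /\
  linear_time_reduction 2 (@chebyshev R) (@monomial R).
Proof.
split.
(* Operations: (2n - 1) + 2 + 1 + 1 = 2n + 3, at most 6n since n > 0. *)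
- exists 6 => n n_gt0; exists (monomial_from_chebyshev R n); split.
  + rewrite /num_calls /= !count_cat.
    by rewrite !(@count_ops R n _ false).
  + rewrite /num_ops /= !count_cat.
    by rewrite !(@count_ops R n _ true) //=; lia.
  + move=> A /(solves_mulP (@size_chebyshev R) (@chebyshev_mul R n)) AE.
    apply/(solves_mulP (@size_monomial R) (@monomial_mul R n)) => f g.
    exact: exec_monomial_from_chebyshev.
(* Operations: three batches of 2n - 1, that is 6n - 3. *)
- exists 6 => n n_gt0; exists (chebyshev_from_monomial R n); split.
  + rewrite /num_calls /= !count_cat.
    by rewrite !(@count_ops R n _ false).
  + rewrite /num_ops /= !count_cat.
    by rewrite !(@count_ops R n _ true) //=; lia.
  + move=> A /(solves_mulP (@size_monomial R) (@monomial_mul R n)) AE.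
    apply/(solves_mulP (@size_chebyshev R) (@chebyshev_mul R n)) => f g.
    exact: exec_chebyshev_from_monomial.
Qed.
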